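(* Let $n\ge1$ be an integer, $r,s\in\mathbb{Z}$, and $z\in\mathbb{C}$ with $z\ne0$, $|z|\neq1$. With the difference operators $\mathcal{L}_1,\dots,\mathcal{L}_4$ and associated functions defined in the context, and assuming in each case that the determinants needed for the objects to be defined are non-zero, we have $$\mathcal{L}_1[\check P_n(z;r)]=\mathcal{L}_1[\hat P_n(z;r)]=0,\qquad \mathcal{L}_2[\check Q_n(z;r)]=\mathcal{L}_2[\hat Q_n(z;r)]=0,$$ $$\mathcal{L}_3[\check R_n(z;s)]=\mathcal{L}_3[\hat R_n(z;s)]=0,\qquad \mathcal{L}_4[\check S_n(z;s)]=\mathcal{L}_4[\hat S_n(z;s)]=0.$$ The non-vanishing assumptions are: for $\mathcal{L}_1$: $D_m^{(r)}\ne0$ ($n\le m\le n+3$), $D_m^{(r-1)}\ne0$ ($n\le m\le n+2$), $D_{n+1}^{(r-2)}\ne0$; for $\mathcal{L}_2$: $D_m^{(r)}\ne0$ ($n\le m\le n+3$), $D_{n+1}^{(r+1)},D_{n+2}^{(r+1)}\ne0$, $D_m^{(r+2)}\ne0$ ($n\le m\le n+2$), $D_{n+1}^{(r+3)}\ne0$; for $\mathcal{L}_3$: $E_m^{(s)}\ne0$ ($n\le m\le n+3$), $E_{n+1}^{(s-1)},E_{n+2}^{(s-1)}\ne0$, $E_m^{(s-2)}\ne0$ ($n\le m\le n+2$); for $\mathcal{L}_4$: $E_m^{(s)}\ne0$ ($n\le m\le n+3$), $E_{n+1}^{(s+1)},E_{n+2}^{(s+1)}\ne0$, $E_{n+1}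^{(s+2)}\ne0$.
   Context: $\mathbb{T}$ is the unit circle, oriented counterclockwise; $w$ is a complex-valued integrable weight on $\mathbb{T}$ with Fourier coefficients $w_k=\int_{\mathbb{T}}\zeta^{-k}w(\zeta)\frac{d\zeta}{2\pi i\zeta}$. For $n\ge1$, $D_n^{(r)}=\det(w_{r+2j-k})_{0\le j,k\le n-1}$, $E_n^{(s)}=\det(w_{s+j-2k})_{0\le j,k\le n-1}$ ($j$ row index, $k$ column index), $D_0^{(r)}=E_0^{(s)}=1$. When $D_n^{(r)}\ne0$, $P_n(z;r)$ and $Q_n(z;r)$ are the unique monic polynomials of degree $n$ with $\int_{\mathbb{T}}P_n(\zeta;r)\zeta^{-2m-r}w(\zeta)\frac{d\zeta}{2\pi i\zeta}=0$ and $\int_{\mathbb{T}}Q_n(\zeta^{-2};r)\zeta^{m-r}w(\zeta)\frac{d\zeta}{2\pi i\zeta}=0$ for $0\le m\le n-1$; for $m=n$ both integrals equal $h_n^{(r)}=D_{n+1}^{(r)}/D_n^{(r)}$. When $E_n^{(s)}\ne0$, $R_n(z;s)$ and $S_n(z;s)$ are the unique monic polynomials of degree $n$ with $\int_{\mathbb{T}}R_n(\zeta^2;s)\zeta^{-m-s}w(\zeta)\frac{d\zeta}{2\pi i\zeta}=0$ and $\int_{\mathbb{T}}S_n(\zeta^{-1};s)\zeta^{2m-s}w(\zeta)\frac{d\zeta}{2\pi i\zeta}=0$ for $0\le m\le n-1$; for $m=n$ both integrals equal $g_n^{(s)}=E_{n+1}^{(s)}/E_n^{(s)}$. Coefficients: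 $\delta_n^{(r)}=-h_n^{(r-1)}/h_n^{(r)}$, $\eta_n^{(r)}=\frac{D_n^{(r+2)}D_{n+1}^{(r-1)}}{D_{n+1}^{(r)}D_n^{(r+1)}}$, $\beta_n^{(r)}=-h_n^{(r+2)}/h_n^{(r)}$, $\alpha_n^{(r)}=\frac{D_n^{(r-1)}D_{n+1}^{(r+2)}}{D_{n+1}^{(r)}D_n^{(r+1)}}$, $\varkappa_n^{(s)}=-g_n^{(s-2)}/g_n^{(s)}$, $\rho_n^{(s)}=\frac{E_n^{(s+1)}E_{n+1}^{(s-2)}}{E_{n+1}^{(s)}E_n^{(s-1)}}$, $\gamma_n^{(s)}=-g_n^{(s+1)}/g_n^{(s)}$, $\theta_n^{(s)}=\frac{E_n^{(s-2)}E_{n+1}^{(s+1)}}{E_{n+1}^{(s)}E_n^{(s-1)}}$. Associated functions: $\hat P_n(z;r)=\int_{\mathbb{T}}\frac{d\zeta}{2\pi i\zeta}w(\zeta)\zeta^{-r}\frac{\zeta^2+z^2}{\zeta^2-z^2}P_n(\zeta;r)$, $\check P_n(z;r)=\int_{\mathbb{T}}\frac{d\zeta}{2\pi i\zeta}w(\zeta)\zeta^{-r}\frac{\zeta^2+z^2}{\zeta^2-z^2}[P_n(\zeta;r)-P_n(z;r)]$; $\hat Q_n(z;r)=\int_{\mathbb{T}}\frac{d\zeta}{2\pi i\zeta}w(\zeta)\zeta^{-r}\frac{\zeta+z}{\zeta-z}Q_n(\zeta^{-2};r)$, $\check Q_n(z;r)=\int_{\mathbb{T}}\frac{d\zeta}{2\pi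 i\zeta}w(\zeta)\zeta^{-r}\frac{\zeta+z}{\zeta-z}[Q_n(\zeta^{-2};r)-Q_n(z^{-2};r)]$; $\hat R_n(z;s)=\int_{\mathbb{T}}\frac{d\zeta}{2\pi i\zeta}w(\zeta)\zeta^{-s}\frac{\zeta+z}{\zeta-z}R_n(\zeta^{2};s)$, $\check R_n(z;s)=\int_{\mathbb{T}}\frac{d\zeta}{2\pi i\zeta}w(\zeta)\zeta^{-s}\frac{\zeta+z}{\zeta-z}[R_n(\zeta^{2};s)-R_n(z^{2};s)]$; $\hat S_n(z;s)=\int_{\mathbb{T}}\frac{d\zeta}{2\pi i\zeta}w(\zeta)\zeta^{-s}\frac{\zeta^2+z^2}{\zeta^2-z^2}S_n(\zeta^{-1};s)$, $\check S_n(z;s)=\int_{\mathbb{T}}\frac{d\zeta}{2\pi i\zeta}w(\zeta)\zeta^{-s}\frac{\zeta^2+z^2}{\zeta^2-z^2}[S_n(\zeta^{-1};s)-S_n(z^{-1};s)]$. Linear difference operators (acting on the index $n$): $$\mathcal{L}_1[f_n(z;r)]=f_{n+3}(z;r)-(\delta_{n+2}^{(r)}+\delta_{n+1}^{(r-1)})f_{n+2}(z;r)+(\delta_{n+1}^{(r-1)}\delta_{n+1}^{(r)}-z^2)f_{n+1}(z;r)+(\delta_n^{(r)}+\eta_n^{(r-2)})z^2f_n(z;r),$$ $$\mathcal{L}_2[f_n(z;r)]=z^2f_{n+3}(z;r)-(1+\beta_{n+2}^{(r)}z^2)f_{n+2}(z;r)+(\beta_{n+1}^{(r)}+\alpha_{n+1}^{(r+1)}+\beta_{n+1}^{(r+1)}+\alpha_{n+1}^{(r+2)})f_{n+1}(z;r)-(\beta_{n+1}^{(r+1)}+\alpha_{n+1}^{(r+2)})(\beta_n^{(r)}+\alpha_n^{(r+1)})f_n(z;r),$$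 $$\mathcal{L}_3[f_n(z;s)]=f_{n+3}(z;s)-(z^2+\varkappa_{n+2}^{(s)})f_{n+2}(z;s)+(\varkappa_{n+1}^{(s)}+\rho_{n+1}^{(s-1)}+\rho_{n+2}^{(s)}+\varkappa_{n+2}^{(s)})z^2f_{n+1}(z;s)-(\rho_{n+2}^{(s)}+\varkappa_{n+2}^{(s)})(\varkappa_n^{(s)}+\rho_n^{(s-1)})z^2f_n(z;s),$$ $$\mathcal{L}_4[f_n(z;s)]=f_{n+3}(z;s)-(\gamma_{n+2}^{(s)}+\gamma_{n+1}^{(s+1)})f_{n+2}(z;s)-(z^{-2}-\gamma_{n+1}^{(s+1)}\gamma_{n+1}^{(s)})f_{n+1}(z;s)+(\theta_{n+1}^{(s+1)}+\gamma_{n+1}^{(s+1)})z^{-2}f_n(z;s).$$ *)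

(* Defs.v *)
From HB Require Import structures.
From mathcomp Require Import all_boot all_order all_algebra.
From mathcomp Require Import complex.
From mathcomp Require Import all_classical all_reals all_analysis.

Set Implicit Arguments.
Unset Strict Implicit.
Unset Printing Implicit Defensive.
Import Order.TTheory GRing.Theory Num.Theory.
Import numFieldNormedType.Exports.

Local Open Scope classical_set_scope.
Local Open Scope complex_scope.
Local Open Scope ring_scope.

Definition circle_point {R : realType} (t : R) : R[i] := cos t +i* sin t.

(* The integral of f over the unit circle against dzeta / (2 pi i zeta), which
   is dt / (2 pi) for zeta = exp(it), 0 <= t <= 2 pi. *)
Definition circle_int {R : realType} (f : R[i] -> R[i]) : R[i] :=
  ((pi *+ 2)^-1)%:C *
  ((\int[@lebesgue_measure R]_(t in `[0, pi *+ 2])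
        complex.Re (f (circle_point t))) +i*
   (\int[@lebesgue_measure R]_(t in `[0, pi *+ 2])
        complex.Im (f (circle_point t)))).

(* A weight on the circle is a function on R[i] of which only the values on the
   unit circle matter. *)
Definition integrable_weight {R : realType} (w : R[i] -> R[i]) : Prop :=
  (@lebesgue_measure R).-integrable `[0, pi *+ 2]
    (EFin \o (fun t => complex.Re (w (circle_point t)))) /\
  (@lebesgue_measure R).-integrable `[0, pi *+ 2]
    (EFin \o (fun t => complex.Im (w (circle_point t)))).

Definition fourier_coef {R : realType} (w : R[i] -> R[i]) (k : int) : R[i] :=
  circle_int (fun zeta => zeta ^ (- k) * w zeta).

Definition detD {R : realType} (w : R[i] -> R[i]) (n : nat) (r : int) : R[i] :=
  \det (\matrix_(j < n, k < n) fourier_coef w (r + 2 * j%:Z - k%:Z)).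

Definition detE {R : realType} (w : R[i] -> R[i]) (n : nat) (s : int) : R[i] :=
  \det (\matrix_(j < n, k < n) fourier_coef w (s + j%:Z - 2 * k%:Z)).

(* polyP, polyQ (resp. polyR, polyS) are the polynomials with the stated
   properties when detD w n r != 0 (resp. detE w n s != 0), which makes them
   unique; their values carry no meaning otherwise. *)
Definition polyP {R : realType} (w : R[i] -> R[i]) (n : nat) (r : int) :
    {poly R[i]} :=
  xget 0 [set p : {poly R[i]} |
    [/\ p \is monic, size p = n.+1 &
        forall m : nat, (m < n)%N ->
          circle_int (fun zeta =>
            p.[zeta] * zeta ^ (- (2 * m%:Z) - r) * w zeta) = 0]].

Definition polyQ {R : realType} (w : R[i] -> R[i]) (n : nat) (r : int) :
    {poly R[i]} :=
  xget 0 [set q : {poly R[i]} |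
    [/\ q \is monic, size q = n.+1 &
        forall m : nat, (m < n)%N ->
          circle_int (fun zeta =>
            q.[zeta ^- 2] * zeta ^ (m%:Z - r) * w zeta) = 0]].

Definition polyR {R : realType} (w : R[i] -> R[i]) (n : nat) (s : int) :
    {poly R[i]} :=
  xget 0 [set p : {poly R[i]} |
    [/\ p \is monic, size p = n.+1 &
        forall m : nat, (m < n)%N ->
          circle_int (fun zeta =>
            p.[zeta ^+ 2] * zeta ^ (- m%:Z - s) * w zeta) = 0]].

Definition polyS {R : realType} (w : R[i] -> R[i]) (n : nat) (s : int) :
    {poly R[i]} :=
  xget 0 [set q : {poly R[i]} |
    [/\ q \is monic, size q = n.+1 &
        forall m : nat, (m < n)%N ->
          circle_int (fun zeta =>
            q.[zeta^-1] * zeta ^ (2 * m%:Z - s) * w zeta) = 0]].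

Definition coef_h {R : realType} (w : R[i] -> R[i]) (n : nat) (r : int) : R[i] :=
  detD w n.+1 r / detD w n r.

Definition coef_g {R : realType} (w : R[i] -> R[i]) (n : nat) (s : int) : R[i] :=
  detE w n.+1 s / detE w n s.

Definition coef_delta {R : realType} (w : R[i] -> R[i]) (n : nat) (r : int) :
    R[i] :=
  - (coef_h w n (r - 1) / coef_h w n r).

Definition coef_eta {R : realType} (w : R[i] -> R[i]) (n : nat) (r : int) :
    R[i] :=
  (detD w n (r + 2) * detD w n.+1 (r - 1)) /
  (detD w n.+1 r * detD w n (r + 1)).

Definition coef_beta {R : realType} (w : R[i] -> R[i]) (n : nat) (r : int) :
    R[i] :=
  - (coef_h w n (r + 2) / coef_h w n r).

Definition coef_alpha {R : realType} (w : R[i] -> R[i]) (n : nat) (r : int) :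
    R[i] :=
  (detD w n (r - 1) * detD w n.+1 (r + 2)) /
  (detD w n.+1 r * detD w n (r + 1)).

Definition coef_kappa {R : realType} (w : R[i] -> R[i]) (n : nat) (s : int) :
    R[i] :=
  - (coef_g w n (s - 2) / coef_g w n s).

Definition coef_rho {R : realType} (w : R[i] -> R[i]) (n : nat) (s : int) :
    R[i] :=
  (detE w n (s + 1) * detE w n.+1 (s - 2)) /
  (detE w n.+1 s * detE w n (s - 1)).

Definition coef_gamma {R : realType} (w : R[i] -> R[i]) (n : nat) (s : int) :
    R[i] :=
  - (coef_g w n (s + 1) / coef_g w n s).

Definition coef_theta {R : realType} (w : R[i] -> R[i]) (n : nat) (s : int) :
    R[i] :=
  (detE w n (s - 2) * detE w n.+1 (s + 1)) /
  (detE w n.+1 s * detE w n (s - 1)).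

Definition hatP {R : realType} (w : R[i] -> R[i]) (n : nat) (r : int)
    (z : R[i]) : R[i] :=
  circle_int (fun zeta =>
    w zeta * zeta ^ (- r) * ((zeta ^+ 2 + z ^+ 2) / (zeta ^+ 2 - z ^+ 2)) *
    (polyP w n r).[zeta]).

Definition checkP {R : realType} (w : R[i] -> R[i]) (n : nat) (r : int)
    (z : R[i]) : R[i] :=
  circle_int (fun zeta =>
    w zeta * zeta ^ (- r) * ((zeta ^+ 2 + z ^+ 2) / (zeta ^+ 2 - z ^+ 2)) *
    ((polyP w n r).[zeta] - (polyP w n r).[z])).

Definition hatQ {R : realType} (w : R[i] -> R[i]) (n : nat) (r : int)
    (z : R[i]) : R[i] :=
  circle_int (fun zeta =>
    w zeta * zeta ^ (- r) * ((zeta + z) / (zeta - z)) *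
    (polyQ w n r).[zeta ^- 2]).

Definition checkQ {R : realType} (w : R[i] -> R[i]) (n : nat) (r : int)
    (z : R[i]) : R[i] :=
  circle_int (fun zeta =>
    w zeta * zeta ^ (- r) * ((zeta + z) / (zeta - z)) *
    ((polyQ w n r).[zeta ^- 2] - (polyQ w n r).[z ^- 2])).

Definition hatR {R : realType} (w : R[i] -> R[i]) (n : nat) (s : int)
    (z : R[i]) : R[i] :=
  circle_int (fun zeta =>
    w zeta * zeta ^ (- s) * ((zeta + z) / (zeta - z)) *
    (polyR w n s).[zeta ^+ 2]).

Definition checkR {R : realType} (w : R[i] -> R[i]) (n : nat) (s : int)
    (z : R[i]) : R[i] :=
  circle_int (fun zeta =>
    w zeta * zeta ^ (- s) * ((zeta + z) / (zeta - z)) *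
    ((polyR w n s).[zeta ^+ 2] - (polyR w n s).[z ^+ 2])).

Definition hatS {R : realType} (w : R[i] -> R[i]) (n : nat) (s : int)
    (z : R[i]) : R[i] :=
  circle_int (fun zeta =>
    w zeta * zeta ^ (- s) * ((zeta ^+ 2 + z ^+ 2) / (zeta ^+ 2 - z ^+ 2)) *
    (polyS w n s).[zeta^-1]).

Definition checkS {R : realType} (w : R[i] -> R[i]) (n : nat) (s : int)
    (z : R[i]) : R[i] :=
  circle_int (fun zeta =>
    w zeta * zeta ^ (- s) * ((zeta ^+ 2 + z ^+ 2) / (zeta ^+ 2 - z ^+ 2)) *
    ((polyS w n s).[zeta^-1] - (polyS w n s).[z^-1])).

(* In the operators, f is the sequence m |-> f_m(z; r) at fixed z and r. *)
Definition opL1 {R : realType} (w : R[i] -> R[i]) (r : int) (z : R[i])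
    (f : nat -> R[i]) (n : nat) : R[i] :=
  f (n + 3)%N
  - (coef_delta w (n + 2) r + coef_delta w (n + 1) (r - 1)) * f (n + 2)%N
  + (coef_delta w (n + 1) (r - 1) * coef_delta w (n + 1) r - z ^+ 2)
    * f (n + 1)%N
  + (coef_delta w n r + coef_eta w n (r - 2)) * z ^+ 2 * f n.

Definition opL2 {R : realType} (w : R[i] -> R[i]) (r : int) (z : R[i])
    (f : nat -> R[i]) (n : nat) : R[i] :=
  z ^+ 2 * f (n + 3)%N
  - (1 + coef_beta w (n + 2) r * z ^+ 2) * f (n + 2)%N
  + (coef_beta w (n + 1) r + coef_alpha w (n + 1) (r + 1)
     + coef_beta w (n + 1) (r + 1) + coef_alpha w (n + 1) (r + 2))
    * f (n + 1)%N
  - (coef_beta w (n + 1) (r + 1) + coef_alpha w (n + 1) (r + 2))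
    * (coef_beta w n r + coef_alpha w n (r + 1)) * f n.

Definition opL3 {R : realType} (w : R[i] -> R[i]) (s : int) (z : R[i])
    (f : nat -> R[i]) (n : nat) : R[i] :=
  f (n + 3)%N
  - (z ^+ 2 + coef_kappa w (n + 2) s) * f (n + 2)%N
  + (coef_kappa w (n + 1) s + coef_rho w (n + 1) (s - 1)
     + coef_rho w (n + 2) s + coef_kappa w (n + 2) s)
    * z ^+ 2 * f (n + 1)%N
  - (coef_rho w (n + 2) s + coef_kappa w (n + 2) s)
    * (coef_kappa w n s + coef_rho w n (s - 1)) * z ^+ 2 * f n.

Definition opL4 {R : realType} (w : R[i] -> R[i]) (s : int) (z : R[i])
    (f : nat -> R[i]) (n : nat) : R[i] :=
  f (n + 3)%N
  - (coef_gamma w (n + 2) s + coef_gamma w (n + 1) (s + 1)) * f (n + 2)%N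
  - (z ^- 2 - coef_gamma w (n + 1) (s + 1) * coef_gamma w (n + 1) s)
    * f (n + 1)%N
  + (coef_theta w (n + 1) (s + 1) + coef_gamma w (n + 1) (s + 1))
    * z ^- 2 * f n.

(* Main.v *)
(* All four families are instances of one: with u = zeta or u = 1/zeta and
   moments mu_t = int u^(-t) w, the polynomial p_n(t) of degree n in X = u^a is
   orthogonal to u^(-t-bj), 0 <= j < n, where {a, b} = {1, 2}: P is u = zeta,
   (a, b) = (1, 2), t = r; Q is u = 1/zeta, (2, 1), t = -r; R is u = zeta,
   (2, 1), t = s; S is u = 1/zeta, (1, 2), t = -s.  Comparing orthogonality
   relations, X p_n(t-a) - p_{n+1}(t) and p_{n+1}(t-b) - p_{n+1}(t) are multiples
   of p_n(t).  Since the steps a and b are commensurable these combine to a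
   recurrence in n at fixed t, and the Desnanot-Jacobi identity turns its
   coefficients into those of the operators.  The operator thus annihilates the
   values of the polynomials at u = v, where v = z or 1/z.  Applied to
   the associated functions the operator leaves int w u^(-t) K (u^2 - v^2) q with
   q = p_{n+1}(t-2) or p_{n+2}(t-2) and K the kernel; K (u^2 - v^2) is a
   quadratic polynomial in u, to which q is orthogonal. *)
Require Import Defs.
From HB Require Import structures.
From mathcomp Require Import all_boot all_order all_algebra.
From mathcomp Require Import complex.
From mathcomp Require Import all_classical all_reals all_analysis.
From mathcomp Require Import measurable_realfun ring.

Set Implicit Arguments.
Unset Strict Implicit.
Unset Printing Implicit Defensive.
Import Order.TTheory GRing.Theory Num.Theory.
Import numFieldNormedType.Exports.

Local Open Scope ring_scope.

(** * Polynomials orthogonal for a moment sequence, and their determinants *)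

Section MomentFunctional.
Variables (F : fieldType) (mu : int -> F) (a b : int).
Implicit Types (p q : {poly F}) (n : nat) (t : int).

(** With [mu t] the moment int u^(-t) w, this is int u^(-t) p(u^a) w. Written through moments, it
    makes everything up to the recurrences algebra over a field. *)
Definition lfun (t : int) (p : {poly F}) : F :=
  \sum_(k < size p) p`_k * mu (t - a * k%:Z).

Lemma lfunE n t p : (size p <= n)%N ->
  lfun t p = \sum_(k < n) p`_k * mu (t - a * k%:Z).
Proof.
move=> sz; rewrite /lfun (big_ord_widen _ (fun k => p`_k * mu (t - a * k%:Z)) sz).
rewrite big_mkcond; apply: eq_bigr => k _; case: ltnP => // h.
by rewrite nth_default // mul0r.
Qed.

Lemma lfun_is_linear t : scalar (lfun t).
Proof.
move=> c p q; set n := maxn (size (c *: p + q)) (maxn (size p) (size q)).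
rewrite (@lfunE n) ?leq_maxl // (@lfunE n _ p) ?(@lfunE n _ q);
  do ?by rewrite /n !leq_max leqnn ?orbT.
rewrite mulr_sumr -big_split; apply: eq_bigr => k _ /=.
by rewrite coefD coefZ mulrDl mulrA.
Qed.

HB.instance Definition _ t :=
  GRing.isLinear.Build F {poly F} F *%R (lfun t) (lfun_is_linear t).

(** The factor X = u^a is absorbed by the index: u^(-t) u^a = u^(-(t-a)). *)
Lemma lfun_mulX t p : lfun t ('X * p) = lfun (t - a) p.
Proof.
rewrite mulrC (@lfunE (size p).+1); last first.
  by rewrite (leq_trans (size_polyMleq _ _)) // size_polyX addn2.
rewrite big_ord_recl coefMX /= mul0r add0r; apply: eq_bigr => k _.
rewrite coefMX /= /bump /= add1n; congr (_ * mu _).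
by rewrite -addn1 PoszD mulrDr mulr1 opprD addrA addrAC.
Qed.

(** Matrix of the functionals [lfun (t + b * j)] on the monomials X^k. For u = zeta its determinant
    is D when (a, b) = (1, 2) and E when (a, b) = (2, 1). *)
Definition tmx n t : 'M[F]_n := \matrix_(j < n, k < n) mu (t + b * j%:Z - a * k%:Z).

Definition tdet n t : F := \det (tmx n t).

(* Cramer's rule for the coefficient of [X^n] *)
Lemma coef_tdet n t p : (size p <= n.+1)%N ->
  p`_n * tdet n.+1 t =
  \sum_(i < n.+1) lfun (t + b * i%:Z) p * cofactor (tmx n.+1 t) i ord_max.
Proof.
move=> sz; pose c : 'cV[F]_n.+1 := \col_k p`_k.
have := congr1 (fun M : 'cV_n.+1 => M ord_max 0) (congr1 (mulmx^~ c) (mul_adj_mx (tmx n.+1 t))).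
rewrite -mulmxA mul_scalar_mx [RHS]mxE [c _ _]mxE /= mulrC => <-.
rewrite mxE; apply: eq_bigr => i _.
rewrite [\adj _ _ _]mxE mulrC; congr (_ * _).
rewrite mxE (lfunE _ sz); apply: eq_bigr => k _.
by rewrite !mxE mulrC.
Qed.

Lemma cofactor_last n t : cofactor (tmx n.+1 t) ord_max ord_max = tdet n t.
Proof.
rewrite /cofactor -signr_odd oddD addbb mul1r; congr (\det _).
by apply/matrixP => i j; rewrite !mxE !lift_max.
Qed.

(** Deleting the first row moves every row index up by one, which shifts t by b. *)
Lemma cofactor_first n t :
  cofactor (tmx n.+1 t) ord0 ord_max = (-1) ^+ n * tdet n (t + b).
Proof.
rewrite /cofactor add0n; congr (_ * \det _).
apply/matrixP => i j; rewrite !mxE !lift_max /= /bump /= add1n.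
by congr (mu (_ - _)); rewrite -addn1 PoszD mulrDr mulr1 addrAC addrA.
Qed.

Definition torth n t p :=
  [/\ p \is monic, size p = n.+1 &
      forall j, (j < n)%N -> lfun (t + b * j%:Z) p = 0].

(** The conditions say that [tmx n t] kills the column of the n coefficients of p, and this matrix
    is invertible. *)
Lemma orth_eq0 n t p : tdet n t != 0 -> (size p <= n)%N ->
  (forall j, (j < n)%N -> lfun (t + b * j%:Z) p = 0) -> p = 0.
Proof.
move=> D0 sz orth; pose c : 'cV[F]_n := \col_k p`_k.
have cE : c = 0.
  have u : tmx n t \in unitmx by rewrite unitmxE unitfE.
  rewrite -[c](mulKmx u); suff -> : tmx n t *m c = 0 by rewrite mulmx0.
  apply/matrixP => j k; rewrite !mxE -[RHS](orth j) // (lfunE _ sz).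
  by apply: eq_bigr => i _; rewrite !mxE mulrC.
apply/polyP => k; rewrite coef0; have [kn|nk] := ltnP k n.
  by have /matrixP/(_ (Ordinal kn) 0) := cE; rewrite !mxE.
by rewrite nth_default // (leq_trans sz).
Qed.

Lemma torth_uniq n t p q : tdet n t != 0 -> torth n t p -> torth n t q -> p = q.
Proof.
move=> D0 [mp sp op] [mq sq oq]; apply/eqP; rewrite -subr_eq0; apply/eqP.
apply: (orth_eq0 D0) => [|j jn]; last by rewrite linearB /= op // oq // subrr.
apply/leq_sizeP => k nk; rewrite coefB; have [<-|nk'] := eqVneq n k.
  have := monicP mp; have := monicP mq; rewrite !lead_coefE sp sq /= => -> ->.
  by rewrite subrr.
by rewrite !nth_default ?subrr // ?sp ?sq ltn_neqAle nk' nk.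
Qed.

Lemma torth_exists n t : tdet n t != 0 -> exists p, torth n t p.
Proof.
move=> D0; have u : tmx n t \in unitmx by rewrite unitmxE unitfE.
(* The lower coefficients solve the linear system that makes X^n - q orthogonal. The default 0
   behind [insub] is never reached, since k < n. *)
pose c := invmx (tmx n t) *m \col_j lfun (t + b * j%:Z) 'X^n.
pose q := \poly_(k < n) (if insub k is Some i then c i 0 else 0).
have sq : (size q <= n)%N by apply: size_poly.
have szp : size ('X^n - q) = n.+1.
  by rewrite size_polyDl ?size_polyXn // size_polyN ltnS.
exists ('X^n - q); split => //.
  by rewrite monicE lead_coefDl ?lead_coefXn // size_polyXn size_polyN ltnS.
move=> j jn; rewrite linearB /=.
have /matrixP/(_ (Ordinal jn) 0) := mulKVmx u (\col_j lfun (t + b * j%:Z) 'X^n).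
rewrite [RHS]mxE /= => <-; rewrite mxE (lfunE _ sq) -sumrB big1 // => k _.
by rewrite mxE coef_poly ltn_ord valK /= mulrC subrr.
Qed.

Lemma torth_coef n t p : torth n t p -> p`_n = 1.
Proof. by case=> /monicP mp sp _; rewrite -mp lead_coefE sp. Qed.

(** In Cramer's rule orthogonality removes every row but the last one. *)
Lemma torth_last n t p : torth n t p ->
  lfun (t + b * n%:Z) p * tdet n t = tdet n.+1 t.
Proof.
move=> tp; have := tp => -[_ sp op]; have := @coef_tdet n t p.
rewrite sp (torth_coef tp) mul1r => /(_ (leqnn _)) ->.
rewrite (bigD1 ord_max) //= cofactor_last big1 ?addr0 // => i im.
by rewrite op ?mul0r // ltn_neqAle im -ltnS ltn_ord.
Qed.

(** Cramer's rule at index t - b: row i + 1 there is condition i at t, so only row 0 survives. *)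
Lemma torth_first n t p : torth n t p ->
  lfun (t - b) p * ((-1) ^+ n * tdet n t) = tdet n.+1 (t - b).
Proof.
move=> tp; have := tp => -[_ sp op]; have := @coef_tdet n (t - b) p.
rewrite sp (torth_coef tp) mul1r => /(_ (leqnn _)) ->.
rewrite big_ord_recl mulr0 addr0 cofactor_first subrK big1 ?addr0 // => i _.
rewrite lift0 -addn1 PoszD mulrDr mulr1 addrA addrAC subrK.
by rewrite op ?mul0r.
Qed.


(** Cramer's rule of size n + 2 applied to X p, with p orthogonal at t + b - a: rows 1 to n vanish,
    and the first and last are evaluated by [torth_first] and [torth_last]. The non-zero determinant
    provides p. *)
Lemma desnanot_jacobi n t : tdet n (t + b - a) != 0 ->
  tdet n.+2 t * tdet n (t + b - a) =
  tdet n.+1 t * tdet n.+1 (t + b - a) - tdet n.+1 (t + b) * tdet n.+1 (t - a).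
Proof.
move=> D0; have [p tp] := torth_exists D0.
have := tp => -[mp sp op].
have sXp : size ('X * p) = n.+2.
  by rewrite mulrC size_mulX ?sp // monic_neq0.
have cXp : ('X * p)`_n.+1 = 1 by rewrite mulrC coefMX /= (torth_coef tp).
have := @coef_tdet n.+1 t ('X * p); rewrite sXp => /(_ (leqnn _)).
rewrite cXp mul1r => ->.
rewrite big_ord_recl big_ord_recr /= cofactor_first big1 => [|i _]; last first.
  rewrite lfun_mulX.
  have -> : (t + b * (bump 0 i)%:Z - a = t + b - a + b * i%:Z)%R.
    by rewrite /bump /= add1n -addn1 PoszD; ring.
  by rewrite op ?mul0r.
have -> : lift ord0 (ord_max : 'I_n.+1) = ord_max by apply/val_inj.
rewrite cofactor_last !lfun_mulX mulr0 addr0 add0r.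
have -> : t + b * (bump 0 n)%:Z - a = t + b - a + b * n%:Z.
  by rewrite /bump /= add1n -addn1 PoszD; ring.
have := torth_first tp; have := torth_last tp => <-.
have -> : t + b - a - b = t - a by ring.
by move=> <-; rewrite exprS; ring.
Qed.

(** The norming constants h or g. *)
Definition thn n t := tdet n.+1 t / tdet n t.

Lemma torth_thn n t p : tdet n t != 0 -> torth n t p ->
  lfun (t + b * n%:Z) p = thn n t.
Proof. by move=> D0 tp; rewrite /thn -(torth_last tp) mulfK. Qed.

(** By [lfun_mulX], X q satisfies the conditions j < n at index t, as p does. The multiple of p is
    chosen so that subtracting it gives condition j = n as well; uniqueness then yields p1. *)
Lemma torth_degree n t p q p1 :
  tdet n t != 0 -> tdet n.+1 t != 0 -> tdet n (t - a) != 0 ->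
  torth n t p -> torth n (t - a) q -> torth n.+1 t p1 ->
  'X * q = p1 + (thn n (t - a) / thn n t) *: p.
Proof.
move=> D0 D1 Da tp tq tp1; have h0 : thn n t != 0 by rewrite mulf_neq0 ?invr_eq0.
apply/eqP; rewrite -subr_eq eq_sym; apply/eqP.
apply: (torth_uniq D1 tp1).
have [mp sp op] := tp; have [mq sq oq] := tq.
have sXq : size ('X * q) = n.+2 by rewrite mulrC size_mulX ?sq // monic_neq0.
have lt_sz : (size (- ((thn n (t - a) / thn n t) *: p)) < size ('X * q)%R)%N.
  by rewrite size_polyN sXq ltnS -sp size_scale_leq.
split.
- by rewrite monicE lead_coefDl // mulrC lead_coefMX -monicE.
- by rewrite size_polyDl.
move=> j; rewrite ltnS leq_eqVlt => /orP[/eqP->|jn].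
  rewrite linearB linearZ /= lfun_mulX (torth_thn D0 tp).
  by rewrite addrAC (torth_thn Da tq) divfK // subrr.
rewrite linearB linearZ /= lfun_mulX op // mulr0.
by rewrite addrAC oq // subrr.
Qed.

(** Condition j + 1 at index t - b is condition j at t, so q1 satisfies those with j < n.
    Subtracting the multiple of p repairs j = n, and uniqueness concludes. *)
Lemma torth_offset n t p p1 q1 :
  tdet n t != 0 -> tdet n.+1 t != 0 -> tdet n.+1 (t - b) != 0 ->
  torth n t p -> torth n.+1 t p1 -> torth n.+1 (t - b) q1 ->
  q1 = p1 + (thn n.+1 (t - b) / thn n t) *: p.
Proof.
move=> D0 D1 Db tp tp1 tq1.
have h0 : thn n t != 0 by rewrite mulf_neq0 ?invr_eq0.
apply/eqP; rewrite -subr_eq eq_sym; apply/eqP.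
apply: (torth_uniq D1 tp1).
have [mp sp op] := tp; have [mq sq oq] := tq1.
have lt_sz : (size (- ((thn n.+1 (t - b) / thn n t) *: p)) < size q1)%N.
  by rewrite size_polyN sq ltnS -sp size_scale_leq.
split.
- by rewrite monicE lead_coefDl // -monicE.
- by rewrite size_polyDl.
have shift j : t + b * j%:Z = t - b + b * (j.+1)%:Z.
  by rewrite -addn1 PoszD; ring.
move=> j; rewrite ltnS leq_eqVlt => /orP[/eqP->|jn].
  rewrite linearB linearZ /= (torth_thn D0 tp) shift.
  by rewrite (torth_thn Db tq1) divfK // subrr.
by rewrite linearB linearZ /= op // mulr0 shift oq // subrr.
Qed.

End MomentFunctional.

(** * Integration over the circle: continuous factors and linearity *)

Section CircleIntegral.
Local Open Scope complex_scope.
Local Open Scope ring_scope.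
Context {R : realType}.
Implicit Types (f g w : R[i] -> R[i]) (c : R[i]).

Let ReM (x y : R[i]) :
  complex.Re (x * y) = complex.Re x * complex.Re y - complex.Im x * complex.Im y.
Proof. by case: x; case: y. Qed.

Let ImM (x y : R[i]) :
  complex.Im (x * y) = complex.Re x * complex.Im y + complex.Im x * complex.Re y.
Proof. by case: x => a b; case: y. Qed.

Let ReD (x y : R[i]) : complex.Re (x + y) = complex.Re x + complex.Re y.
Proof. by case: x; case: y. Qed.

Let ImD (x y : R[i]) : complex.Im (x + y) = complex.Im x + complex.Im y.
Proof. by case: x; case: y. Qed.

(** Continuity in the angle, split into real and imaginary parts to match [integrable_weight]. *)
Definition circle_continuous g :=
  continuous (fun t => complex.Re (g (circle_point t)) : R) /\
  continuous (fun t => complex.Im (g (circle_point t)) : R).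

Lemma circle_continuous_cst c : circle_continuous (fun=> c).
Proof. by split => t; apply: cvg_cst. Qed.

Lemma circle_continuous_id : circle_continuous id.
Proof. by split => t; [exact: continuous_cos | exact: continuous_sin]. Qed.

Lemma circle_continuousD f g : circle_continuous f -> circle_continuous g ->
  circle_continuous (fun x => f x + g x).
Proof.
move=> [f1 f2] [g1 g2]; split => t.
  rewrite (_ : (fun _ => _) = (fun t => complex.Re (f (circle_point t))) \+
    (fun t => complex.Re (g (circle_point t)))); last first.
    by apply/funext => x; rewrite ReD.
  by apply: continuousD; [exact: f1 | exact: g1].
rewrite (_ : (fun _ => _) = (fun t => complex.Im (f (circle_point t))) \+
  (fun t => complex.Im (g (circle_point t)))); last first.
  by apply/funext => x; rewrite ImD.
by apply: continuousD; [exact: f2 | exact: g2].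
Qed.

Lemma circle_continuousM f g : circle_continuous f -> circle_continuous g ->
  circle_continuous (fun x => f x * g x).
Proof.
move=> [f1 f2] [g1 g2]; split => t.
  rewrite (_ : (fun _ => _) =
    (fun t => complex.Re (f (circle_point t)) * complex.Re (g (circle_point t))) \-
    (fun t => complex.Im (f (circle_point t)) * complex.Im (g (circle_point t))));
    last by apply/funext => x; rewrite ReM.
  by apply: continuousB; apply: continuousM;
    [exact: f1 | exact: g1 | exact: f2 | exact: g2].
rewrite (_ : (fun _ => _) =
  (fun t => complex.Re (f (circle_point t)) * complex.Im (g (circle_point t))) \+
  (fun t => complex.Im (f (circle_point t)) * complex.Re (g (circle_point t))));
  last by apply/funext => x; rewrite ImM.
by apply: continuousD; apply: continuousM;
  [exact: f1 | exact: g2 | exact: f2 | exact: g1].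
Qed.

Lemma circle_continuousV g : (forall t, g (circle_point t) != 0) ->
  circle_continuous g -> circle_continuous (fun x => (g x)^-1).
Proof.
move=> g0 [g1 g2]; pose re t : R := complex.Re (g (circle_point t)).
pose im t : R := complex.Im (g (circle_point t)).
(* The inverse is the conjugate divided by the squared modulus [N]. *)
pose N := (re \* re) \+ (im \* im).
have N0 t : N t != 0.
  apply: contra (g0 t); rewrite /N /= -!expr2 paddr_eq0 ?sqr_ge0 // !sqrf_eq0.
  by rewrite /re /im eq_complex.
have cN : continuous N.
  by move=> t; apply: continuousD; apply: continuousM;
    [exact: g1 | exact: g1 | exact: g2 | exact: g2].
have cV t : {for t, continuous (fun x => (N x)^-1)}.
  by apply: continuousV; [exact: N0 | exact: cN].
split => t.
  rewrite (_ : (fun _ => _) = fun x => re x * (N x)^-1).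
    by apply: continuousM; [exact: g1 | exact: cV].
  by apply/funext => x; rewrite /N /= /re /im -!expr2; case: (g _).
rewrite (_ : (fun _ => _) = \- (im \* (fun x => (N x)^-1))).
  by apply: continuousN; apply: continuousM; [exact: g2 | exact: cV].
by apply/funext => x; rewrite /N /= /re /im -!expr2; case: (g _).
Qed.

Lemma circle_continuousX g n : circle_continuous g ->
  circle_continuous (fun x => g x ^+ n).
Proof.
move=> cg; elim: n => [|n IH]; first exact: (circle_continuous_cst 1).
rewrite (_ : (fun _ => _) = fun x => g x * g x ^+ n); last first.
  by apply/funext => x; rewrite exprS.
exact: circle_continuousM.
Qed.

Lemma circle_continuous_exprz g (k : int) : (forall t, g (circle_point t) != 0) ->
  circle_continuous g -> circle_continuous (fun x => g x ^ k).
Proof.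
move=> g0 cg; case: k => n; first exact: circle_continuousX.
rewrite (_ : (fun _ => _) = fun x => (g x ^+ n.+1)^-1) //.
apply: circle_continuousV; last exact: circle_continuousX.
by move=> t; rewrite expf_neq0.
Qed.

Lemma circle_continuous_horner (p : {poly R[i]}) g : circle_continuous g ->
  circle_continuous (fun x => p.[g x]).
Proof.
move=> cg; elim/poly_ind: p => [|p c IH].
  rewrite (_ : (fun _ => _) = fun=> 0); first exact: circle_continuous_cst.
  by apply/funext => x; rewrite horner0.
rewrite (_ : (fun _ => _) = fun x => p.[g x] * g x + c); last first.
  by apply/funext => x; rewrite hornerMXaddC.
apply: circle_continuousD; last exact: circle_continuous_cst.
exact: circle_continuousM.
Qed.

(** A continuous function is bounded on the compact interval, and a bounded measurable factor
    preserves integrability. *)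
Let integrableM_continuous (f g : R -> R) :
  (@lebesgue_measure R).-integrable `[0, pi *+ 2] (EFin \o f) -> continuous g ->
  (@lebesgue_measure R).-integrable `[0, pi *+ 2]
    (EFin \o (fun t => f t * g t)).
Proof.
move=> fi cg.
have cgI : {within `[0, pi *+ 2]%classic, continuous (g : R -> R^o)}%classic.
  exact: continuous_subspaceT.
apply: (integrableMl _ fi) => //.
  by apply: subspace_continuous_measurable_fun.
have /compact_bounded[M [_ mrt]] := continuous_compact cgI (@segment_compact _ _ _).
by exists M; split; rewrite ?num_real // => ? ? ? ?; exact: mrt.
Qed.

Lemma integrable_weightM w g : integrable_weight w -> circle_continuous g ->
  integrable_weight (fun x => w x * g x).
Proof.
move=> [w1 w2] [g1 g2]; split.
  rewrite (_ : (fun _ => _) = fun t => 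
    complex.Re (w (circle_point t)) * complex.Re (g (circle_point t)) -
    complex.Im (w (circle_point t)) * complex.Im (g (circle_point t))); last first.
    by apply/funext => t; rewrite ReM.
  apply: (@integrableB _ _ _ _ _ _ (EFin \o _) (EFin \o _)) => //;
    exact: integrableM_continuous.
rewrite (_ : (fun _ => _) = fun t => 
  complex.Re (w (circle_point t)) * complex.Im (g (circle_point t)) +
  complex.Im (w (circle_point t)) * complex.Re (g (circle_point t))); last first.
  by apply/funext => t; rewrite ImM.
apply: (@integrableD _ _ _ _ _ _ (EFin \o _) (EFin \o _)) => //;
  exact: integrableM_continuous.
Qed.

Lemma integrable_weightD f g : integrable_weight f -> integrable_weight g ->
  integrable_weight (fun x => f x + g x).
Proof.
move=> [f1 f2] [g1 g2]; split.
  rewrite (_ : (fun _ => _) = fun t =>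
    complex.Re (f (circle_point t)) + complex.Re (g (circle_point t))).
    exact: (@integrableD _ _ _ _ _ _ (EFin \o _) (EFin \o _)).
  by apply/funext => t; rewrite ReD.
rewrite (_ : (fun _ => _) = fun t =>
  complex.Im (f (circle_point t)) + complex.Im (g (circle_point t))).
  exact: (@integrableD _ _ _ _ _ _ (EFin \o _) (EFin \o _)).
by apply/funext => t; rewrite ImD.
Qed.

Lemma eq_circle_int f g : (forall t, f (circle_point t) = g (circle_point t)) ->
  circle_int f = circle_int g.
Proof.
move=> fg; rewrite /circle_int.
congr (_ * (_ +i* _)); apply: eq_Rintegral => t _; by rewrite fg.
Qed.

Lemma circle_intD f g : integrable_weight f -> integrable_weight g ->
  circle_int (fun x => f x + g x) = circle_int f + circle_int g.
Proof.
move=> [f1 f2] [g1 g2]; rewrite /circle_int -mulrDr; congr (_ * _).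
under eq_Rintegral do rewrite ReD.
under [in X in _ +i* X]eq_Rintegral do rewrite ImD.
by rewrite !RintegralD.
Qed.

Lemma circle_intZ c f : integrable_weight f ->
  circle_int (fun x => c * f x) = c * circle_int f.
Proof.
move=> [f1 f2]; rewrite /circle_int mulrCA; congr (_ * _).
under eq_Rintegral do rewrite ReM.
under [in X in _ +i* X]eq_Rintegral do rewrite ImM.
have mI : measurable `[0%R, (pi *+ 2 : R)]%classic by [].
rewrite RintegralB ?RintegralD //; 
  try exact: (@integrableZl _ _ _ _ _ _ _ (EFin \o _)).
by rewrite !RintegralZl //; case: c.
Qed.

End CircleIntegral.

(** * Recurrences in the degree at a fixed index *)

Section Recurrences.
Variables (F : fieldType) (mu : int -> F) (a b : int).
Implicit Types (n : nat) (t : int) (p q : {poly F}).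
Local Notation D := (tdet mu a b).
Local Notation h := (thn mu a b).
Local Notation orth := (torth mu a b).

(** Minus this ratio is delta, beta, kappa, gamma for P, Q, R, S respectively. *)
Definition degree_coef n t := h n (t - a) / h n t.
Definition offset_coef n t := h n.+1 (t - b) / h n t.

(** Desnanot-Jacobi at t - b eliminates D_{n+2}(t-b), the numerator of h_{n+1}(t-b). The subtracted
    fraction becomes eta, alpha or rho in L1, L2 and L3. *)
Lemma offset_coefE n t :
  D n t != 0 -> D n.+1 t != 0 -> D n (t - a) != 0 -> D n.+1 (t - b) != 0 ->
  offset_coef n t = degree_coef n t -
    (D n t * D n.+1 (t - b - a)) / (D n.+1 (t - b) * D n (t - a)).
Proof.
move=> D0 D1 Da Db; have := @desnanot_jacobi _ mu a b n (t - b).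
rewrite subrK => /(_ Da); rewrite /offset_coef /degree_coef /thn.
(* With the determinants as variables, the difference of the two sides is the identity [E], brought
   to one side, times a fraction. *)
move: (D n.+2 _) (D n.+1 (t - b - a)) (D n.+1 (t - a)) Db D0 D1 Da.
move: (D n t) (D n.+1 t) (D n (t - a)) (D n.+1 (t - b)).
move=> x0 x1 xa xb y2 yab ya xb0 x00 x10 xa0 E.
apply/eqP; rewrite -subr_eq0.
have -> : y2 / xb / (x1 / x0) - (ya / xa / (x1 / x0) - x0 * yab / (xb * xa)) =
  (y2 * xa - (xb * ya - x1 * yab)) * (x0 / (xa * xb * x1)) by field; rewrite ?xa0 ?xb0 ?x10 ?x00.
by rewrite E subrr mul0r.
Qed.

(** Desnanot-Jacobi at t + a - b eliminates D_n(t) instead, leaving only determinants of sizes n + 1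
    and n + 2. This is the shape of rho + kappa at n + 2 in L3 and of theta + gamma in L4. *)
Lemma offset_coefE' n t :
  D n t != 0 -> D n.+1 t != 0 -> D n.+1 (t + a - b) != 0 ->
  D n.+2 (t + a - b) != 0 -> D n.+1 (t - b) != 0 ->
  offset_coef n t = h n.+1 (t - b) / h n.+1 (t + a - b) -
    (D n.+1 (t + a) * D n.+2 (t - b)) / (D n.+2 (t + a - b) * D n.+1 t).
Proof.
move=> D0 D1 Dab Dab2 Db; have := @desnanot_jacobi _ mu a b n (t + a - b).
rewrite subrK addrK (_ : t + a - b - a = t - b); last by ring.
move=> /(_ D0); rewrite /offset_coef /thn.
move: (D n.+1 (t + a)) (D n.+2 (t - b)) D0 D1 Dab Dab2 Db.
move: (D n t) (D n.+1 t) (D n.+1 (t + a - b)) (D n.+2 (t + a - b)) (D n.+1 (t - b)).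
move=> x0 x1 xab yab xb xa yb x00 x10 xab0 yab0 xb0 E.
apply/eqP; rewrite -subr_eq0.
have -> : yb / xb / (x1 / x0) - (yb / xb / (yab / xab) - xa * yb / (yab * x1)) =
  (yab * x0 - (xab * x1 - xa * xb)) * (yb / (xb * x1 * yab)).
  by field; rewrite ?x00 ?x10 ?xab0 ?yab0 ?xb0.
by rewrite E subrr mul0r.
Qed.

(** Since b = 2a, the polynomial q = p_{n+1}(t-b) is reached from index t in two ways: by one step
    of [torth_offset], and, after multiplication by X^2, by two steps of [torth_degree] through
    index t - a. *)
Lemma double_offset_recurrence n t p0 p1 p2 p3 : b = a + a ->
  D n t != 0 -> D n.+1 t != 0 -> D n.+2 t != 0 -> D n.+3 t != 0 ->
  D n.+1 (t - a) != 0 -> D n.+2 (t - a) != 0 -> D n.+1 (t - b) != 0 ->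
  orth n t p0 -> orth n.+1 t p1 -> orth n.+2 t p2 -> orth n.+3 t p3 ->
  exists q, [/\ orth n.+1 (t - b) q, q = p1 + offset_coef n t *: p0 &
    'X ^+ 2 * q = p3 + (degree_coef n.+2 t + degree_coef n.+1 (t - a)) *: p2 +
      (degree_coef n.+1 (t - a) * degree_coef n.+1 t) *: p1].
Proof.
move=> ba D0 D1 D2 D3 Da1 Da2 Db t0 t1 t2 t3.
have [q tq] := torth_exists Db; exists q; split => //.
  by have := torth_offset D0 D1 Db t0 t1 tq.
have [r1 tr1] := torth_exists Da1; have [r2 tr2] := torth_exists Da2.
have e1 := torth_degree D1 D2 Da1 t1 tr1 t2.
have e2 := torth_degree D2 D3 Da2 t2 tr2 t3.
have ta : t - b = t - a - a by rewrite ba; ring.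
have Db' := Db; have tq' := tq; rewrite ta in Db' tq'.
have e3 := torth_degree Da1 Da2 Db' tr1 tq' tr2.
rewrite expr2 -mulrA e3 mulrDr e2 -scalerAr e1 !scalerDr !scalerA scalerDl.
by rewrite !addrA.
Qed.

(** The mirror case a = 2b: q = p_{n+2}(t-a) is reached by one step of [torth_degree] and by two
    steps of [torth_offset] through index t - b. *)
Lemma double_degree_recurrence n t p0 p1 p2 p3 : a = b + b ->
  D n t != 0 -> D n.+1 t != 0 -> D n.+2 t != 0 -> D n.+3 t != 0 ->
  D n.+1 (t - b) != 0 -> D n.+2 (t - b) != 0 -> D n.+2 (t - a) != 0 ->
  orth n t p0 -> orth n.+1 t p1 -> orth n.+2 t p2 -> orth n.+3 t p3 ->
  exists q, [/\ orth n.+2 (t - a) q, 'X * q = p3 + degree_coef n.+2 t *: p2 &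
    q = p2 + (offset_coef n.+1 t + offset_coef n.+1 (t - b)) *: p1 +
      (offset_coef n.+1 (t - b) * offset_coef n t) *: p0].
Proof.
move=> ab D0 D1 D2 D3 Db1 Db2 Da t0 t1 t2 t3.
have [q tq] := torth_exists Da; exists q; split => //.
  exact: torth_degree D2 D3 Da t2 tq t3.
have [r1 tr1] := torth_exists Db1; have [r2 tr2] := torth_exists Db2.
have e1 := torth_offset D0 D1 Db1 t0 t1 tr1.
have e2 := torth_offset D1 D2 Db2 t1 t2 tr2.
have ta : t - a = t - b - b by rewrite ab; ring.
have Da' := Da; have tq' := tq; rewrite ta in Da' tq'.
rewrite (torth_offset Db1 Db2 Da' tr1 tr2 tq') e2 e1 -/(offset_coef _ _).
by rewrite scalerDr scalerA scalerDl !addrA.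
Qed.

End Recurrences.

(** * Linear forms applied to a relation between polynomials *)

Section LinearForm.
Variables (F : fieldType) (L : {poly F} -> F) (x : F).
Hypothesis L_scalar : scalar L.
Implicit Types (p q : {poly F}).

Lemma scalar_form0 : L 0 = 0.
Proof.
have := L_scalar 1 0 0; rewrite scale1r addr0 mul1r.
by move=> /(congr1 (fun y => y - L 0)); rewrite subrr addrK.
Qed.

(** This treats hat and check functions together: L(p - p(x)) = L p - p(x) L 1, so the second
    combination is L G - G(x) L 1. *)
Lemma scalar_form_comb c3 c2 c1 c0 (p3 p2 p1 p0 : {poly F}) :
  let G := c3 *: p3 + (c2 *: p2 + (c1 *: p1 + (c0 *: p0 + 0))) in
  L G = 0 -> G.[x] = 0 ->
  (c3 * L p3 + c2 * L p2 + c1 * L p1 + c0 * L p0 = 0) /\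
  (c3 * L (p3 - p3.[x]%:P) + c2 * L (p2 - p2.[x]%:P) +
   c1 * L (p1 - p1.[x]%:P) + c0 * L (p0 - p0.[x]%:P) = 0).
Proof.
(* The trailing zero in [G] lets [L_scalar], which expects c *: p + q, unfold every term. *)
move=> G; rewrite /G !L_scalar scalar_form0 !(hornerD, hornerZ, horner0) !addr0 => e1 e2.
have sub p : L (p - p.[x]%:P) = L p - p.[x] * L 1.
  by rewrite -alg_polyC -scaleNr addrC L_scalar mulNr addrC.
split; first by rewrite -!addrA.
rewrite !sub.
transitivity ((c3 * L p3 + (c2 * L p2 + (c1 * L p1 + c0 * L p0))) -
  (c3 * p3.[x] + (c2 * p2.[x] + (c1 * p1.[x] + c0 * p0.[x]))) * L 1); first by ring.
by rewrite e1 e2 mul0r subr0.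
Qed.

Lemma scalar_form_sum n (c : 'I_n -> F) (p : 'I_n -> {poly F}) :
  L (\sum_(i < n) c i *: p i) = \sum_(i < n) c i * L (p i).
Proof.
elim: n c p => [|n IH] c p; first by rewrite !big_ord0 scalar_form0.
by rewrite !big_ord_recl L_scalar IH.
Qed.

End LinearForm.

(** * Kernel integrals as linear forms, and their annihilation in the two cases *)

Section CircleForm.
Context {R : realType}.
Variable w : R[i] -> R[i].
Hypothesis w_int : integrable_weight w.
Implicit Types (p q : {poly R[i]}) (g h u K : R[i] -> R[i]).

(** With g = u^(-t) K and h = u^a this is the hat function of p, and the check function when p is
    replaced by p - p(v^a). With K = 1 it is [lfun]. *)
Definition circle_form g h p : R[i] := circle_int (fun x => w x * g x * p.[h x]).

Lemma circle_form_scalar g h : circle_continuous g -> circle_continuous h ->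
  scalar (circle_form g h).
Proof.
move=> cg ch c p q; have int r : integrable_weight (fun x => w x * g x * r.[h x]).
  by apply: integrable_weightM (circle_continuous_horner r ch); exact: integrable_weightM.
rewrite /circle_form -circle_intZ // -circle_intD //; last first.
  rewrite (_ : (fun _ => _) = fun x => w x * g x * (c *: p).[h x]) //.
  by apply/funext => x; rewrite hornerZ mulrCA.
by congr circle_int; apply/funext => x; rewrite hornerD hornerZ mulrDr mulrCA.
Qed.

Variable u : R[i] -> R[i].
Hypothesis u_cont : circle_continuous u.
Hypothesis u_neq0 : forall s, u (circle_point s) != 0.

Definition moment (t : int) : R[i] := circle_int (fun x => w x * u x ^ (- t)).

Lemma circle_form_lfun (a : nat) (t : int) p :
  circle_form (fun x => u x ^ (- t)) (fun x => u x ^+ a) p =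
  lfun moment a%:Z t p.
Proof.
have cL := circle_form_scalar (circle_continuous_exprz (- t) u_neq0 u_cont)
  (circle_continuousX a u_cont).
rewrite -[in LHS](coefK p) poly_def (scalar_form_sum cL) /lfun.
apply: eq_bigr => k _; congr (_ * _); apply: eq_circle_int => s.
rewrite hornerXn -exprM -mulrA; congr (_ * _).
by rewrite opprB addrC expfzDr // mulrC.
Qed.

(* Multiplying the kernel [K] by [T] leaves the Laurent polynomial
   [c0 + c1 u + c2 u^2], so only three moments of [q] survive. *)
Lemma circle_form_kernel (a : nat) (t : int) K (T q : {poly R[i]}) c0 c1 c2 :
  (forall s, let x := u (circle_point s) in
    K (circle_point s) * T.[x ^+ a] = c0 + c1 * x + c2 * x ^+ 2) ->
  c0 * lfun moment a%:Z t q = 0 ->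
  c1 * lfun moment a%:Z (t - 1) q = 0 ->
  c2 * lfun moment a%:Z (t - 2) q = 0 ->
  circle_form (fun x => u x ^ (- t) * K x) (fun x => u x ^+ a) (T * q) = 0.
Proof.
move=> KT; rewrite -!circle_form_lfun /circle_form.
have int t' : integrable_weight (fun x => w x * u x ^ (- t') * q.[u x ^+ a]).
  apply: integrable_weightM (circle_continuous_horner q (circle_continuousX a u_cont)).
  exact: integrable_weightM (circle_continuous_exprz _ u_neq0 u_cont).
have intZ c t' : integrable_weight (fun x => c * (w x * u x ^ (- t') * q.[u x ^+ a])).
  have := integrable_weightM (int t') (circle_continuous_cst c).
  by congr integrable_weight; apply/funext => x; rewrite mulrC.
rewrite -!circle_intZ // => e0 e1 e2.
rewrite -[RHS]addr0 -{1}[0]addr0 -{1}e0 -{1}e1 -e2 -!circle_intD //; last exact: integrable_weightD.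
apply: eq_circle_int => s; have := KT s; rewrite hornerM.
have -> : u (circle_point s) ^ (- (t - 1)) =
    u (circle_point s) ^ (- t) * u (circle_point s).
  by rewrite opprB addrC expfzDr.
have -> : u (circle_point s) ^ (- (t - 2)) =
    u (circle_point s) ^ (- t) * u (circle_point s) ^+ 2.
  by rewrite opprB addrC expfzDr.
move: (u _) (w _) (K _) => x y k /=.
move: (x ^ _) T.[_] q.[_] => X T' Q E.
transitivity (y * X * Q * (k * T')); first by ring.
by rewrite E; ring.
Qed.

(** The recurrence turns the operator into (X^2 - v^2) q with q = p_{n+1}(t-2). This vanishes at X =
    v, and the kernel reduces the factor to c (u^2 + v^2). *)
Lemma double_offset_form (v : R[i]) K c (t : int) n p0 p1 p2 p3 :
  circle_continuous K ->
  (forall s, K (circle_point s) * (u (circle_point s) ^+ 2 - v ^+ 2) =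
    c * (u (circle_point s) ^+ 2 + v ^+ 2)) ->
  (0 < n)%N ->
  let D := tdet moment 1 2 in
  let orth := torth moment 1 2 in
  D n t != 0 -> D n.+1 t != 0 -> D n.+2 t != 0 -> D n.+3 t != 0 ->
  D n.+1 (t - 1) != 0 -> D n.+2 (t - 1) != 0 -> D n.+1 (t - 2) != 0 ->
  orth n t p0 -> orth n.+1 t p1 -> orth n.+2 t p2 -> orth n.+3 t p3 ->
  let kap := degree_coef moment 1 2 in
  let L := circle_form (fun x => u x ^ (- t) * K x) (fun x => u x ^+ 1) in
  let op f3 f2 f1 f0 := f3 + (kap n.+2 t + kap n.+1 (t - 1)) * f2 +
    (kap n.+1 (t - 1) * kap n.+1 t - v ^+ 2) * f1 -
    offset_coef moment 1 2 n t * v ^+ 2 * f0 in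
  op (L p3) (L p2) (L p1) (L p0) = 0 /\
  op (L (p3 - p3.[v]%:P)) (L (p2 - p2.[v]%:P)) (L (p1 - p1.[v]%:P))
     (L (p0 - p0.[v]%:P)) = 0.
Proof.
move=> cK KE n0 D orth D0 D1 D2 D3 Da1 Da2 Db t0 t1 t2 t3 kap L op.
have [//|q [tq qE rec]] := double_offset_recurrence _ D0 D1 D2 D3 Da1 Da2 Db t0 t1 t2 t3.
have cL : scalar L.
  apply: circle_form_scalar; last exact: circle_continuousX.
  exact: circle_continuousM (circle_continuous_exprz _ u_neq0 u_cont) cK.
pose c2 := kap n.+2 t + kap n.+1 (t - 1).
pose c1 := kap n.+1 (t - 1) * kap n.+1 t - v ^+ 2.
pose c0 := - (offset_coef moment 1 2 n t * v ^+ 2).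
have GE : 1 *: p3 + (c2 *: p2 + (c1 *: p1 + (c0 *: p0 + 0))) =
    ('X ^+ 2 - (v ^+ 2)%:P) * q.
  rewrite mulrBl rec mul_polyC qE scalerDr scalerA /c0 /c1 scaleNr scalerBl scale1r.
  by rewrite addr0 !opprD !addrA [v ^+ 2 * _]mulrC.
have := @scalar_form_comb _ L v cL 1 c2 c1 c0 p3 p2 p1 p0.
rewrite GE; case.
- have [_ _ oq] := tq.
  (* The moments of q at t and t - 2 are its conditions j = 1 and j = 0; j = 1 is below the degree n
     + 1 because n >= 1. *)
  apply: (@circle_form_kernel 1 t K _ q (c * v ^+ 2) 0 c).
  + move=> s x; rewrite expr1 !hornerE /= -/x KE -/x; ring.
  + by have := oq 1%N; rewrite mulr1 subrK => ->; rewrite ?mulr0.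
  + by rewrite mul0r.
  + by have := oq 0%N; rewrite mulr0 addr0 => ->; rewrite ?mulr0.
- by rewrite !hornerE subrr mul0r.
by rewrite !mul1r /op /c2 /c1 /c0 !mulNr.
Qed.

(** Here X = u^2, the operator becomes (X - v^2) q with q = p_{n+2}(t-2), and the kernel reduces the
    factor to c (u + v)^2. *)
Lemma double_degree_form (v : R[i]) K c (t : int) n p0 p1 p2 p3 :
  circle_continuous K ->
  (forall s, K (circle_point s) * (u (circle_point s) ^+ 2 - v ^+ 2) =
    c * (u (circle_point s) + v) ^+ 2) ->
  (0 < n)%N ->
  let D := tdet moment 2 1 in
  let orth := torth moment 2 1 in
  D n t != 0 -> D n.+1 t != 0 -> D n.+2 t != 0 -> D n.+3 t != 0 ->
  D n.+1 (t - 1) != 0 -> D n.+2 (t - 1) != 0 -> D n.+2 (t - 2) != 0 ->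
  orth n t p0 -> orth n.+1 t p1 -> orth n.+2 t p2 -> orth n.+3 t p3 ->
  let off := offset_coef moment 2 1 in
  let L := circle_form (fun x => u x ^ (- t) * K x) (fun x => u x ^+ 2) in
  let op f3 f2 f1 f0 := f3 + (degree_coef moment 2 1 n.+2 t - v ^+ 2) * f2 -
    ((off n.+1 t + off n.+1 (t - 1)) * v ^+ 2) * f1 -
    (off n.+1 (t - 1) * off n t) * v ^+ 2 * f0 in
  op (L p3) (L p2) (L p1) (L p0) = 0 /\
  op (L (p3 - p3.[v ^+ 2]%:P)) (L (p2 - p2.[v ^+ 2]%:P))
     (L (p1 - p1.[v ^+ 2]%:P)) (L (p0 - p0.[v ^+ 2]%:P)) = 0.
Proof.
move=> cK KE n0 D orth D0 D1 D2 D3 Db1 Db2 Da t0 t1 t2 t3 off L op.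
have [//|q [tq rec qE]] := double_degree_recurrence _ D0 D1 D2 D3 Db1 Db2 Da t0 t1 t2 t3.
have cL : scalar L.
  apply: circle_form_scalar; last exact: circle_continuousX.
  exact: circle_continuousM (circle_continuous_exprz _ u_neq0 u_cont) cK.
pose c2 := degree_coef moment 2 1 n.+2 t - v ^+ 2.
pose c1 := - ((off n.+1 t + off n.+1 (t - 1)) * v ^+ 2).
pose c0 := - (off n.+1 (t - 1) * off n t * v ^+ 2).
have GE : 1 *: p3 + (c2 *: p2 + (c1 *: p1 + (c0 *: p0 + 0))) =
    ('X - (v ^+ 2)%:P) * q.
  rewrite mulrBl rec mul_polyC qE !scalerDr !scalerA /c0 /c1 /c2 !scaleNr scalerBl scale1r.
  by rewrite addr0 !opprD !addrA ![v ^+ 2 * _]mulrC.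
have := @scalar_form_comb _ L (v ^+ 2) cL 1 c2 c1 c0 p3 p2 p1 p0.
rewrite GE; case.
- have [_ _ oq] := tq.
  (* All three moments of q occur, as conditions j = 2, 1, 0; j = 2 is below the degree n + 2
     because n >= 1. *)
  apply: (@circle_form_kernel 2 t K _ q (c * v ^+ 2) (c * v *+ 2) c).
  + move=> s x; rewrite !hornerE /= KE -/x; ring.
  + by have := oq 2%N; rewrite mul1r subrK => ->; rewrite ?mulr0.
  + by have := oq 1%N; rewrite mul1r (_ : t - 2 + 1%:Z = t - 1); [move=> ->; rewrite ?mulr0 | ring].
  + by have := oq 0%N; rewrite mulr0 addr0 => ->; rewrite ?mulr0.
- by rewrite !hornerE subrr mul0r.
by rewrite !mul1r /op /c2 /c1 /c0 !mulNr.
Qed.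

End CircleForm.

(** * The four families, their determinants and their kernels as instances *)

Section Specialization.
Context {R : realType}.
Variable w : R[i] -> R[i].
Hypothesis w_int : integrable_weight w.

Lemma circle_point_neq0 (t : R) : circle_point t != 0.
Proof.
apply: contra_neq (oner_neq0 R) => /eqP; rewrite eq_complex /= => /andP[/eqP c0 /eqP s0].
by rewrite -(cos2Dsin2 t) c0 s0 expr0n addr0.
Qed.

Lemma norm_circle_point (t : R) : `|circle_point t| = 1.
Proof. by rewrite normc_def /= cos2Dsin2 sqrtr1. Qed.

Lemma circle_continuous_inv : circle_continuous (@GRing.inv R[i]).
Proof. exact: circle_continuousV circle_point_neq0 circle_continuous_id. Qed.

Lemma circle_point_inv_neq0 (t : R) : (circle_point t)^-1 != 0.
Proof. by rewrite invr_eq0 circle_point_neq0. Qed.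

(** The non-zero determinant gives existence, so [xget] picks a genuine member and not the default
    0. *)
Lemma xget_torth (F : fieldType) (mu : int -> F) a b n t (A : set {poly F}) :
  (forall p, A p <-> torth mu a b n t p) -> tdet mu a b n t != 0 ->
  torth mu a b n t (xget 0 A).
Proof.
move=> AE /torth_exists[p tp]; apply/AE; apply: xgetPex.
by exists p; apply/AE.
Qed.

Lemma fourier_coef_moment t : fourier_coef w t = moment w id t.
Proof. by apply: eq_circle_int => s; rewrite mulrC. Qed.

Lemma fourier_coef_moment_inv t : fourier_coef w t = moment w GRing.inv (- t).
Proof. by apply: eq_circle_int => s; rewrite mulrC opprK exprz_inv. Qed.

Lemma detD_tdet n r : detD w n r = tdet (moment w id) 1 2 n r.
Proof.
by congr (\det _); apply/matrixP => i j; rewrite !mxE fourier_coef_moment mul1r.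
Qed.

Lemma detE_tdet n s : detE w n s = tdet (moment w id) 2 1 n s.
Proof.
by congr (\det _); apply/matrixP => i j; rewrite !mxE fourier_coef_moment mul1r.
Qed.

(** Passing to u = 1/zeta negates all indices; after transposition the row step is 1 and the column
    step 2. *)
Lemma detD_tdet_inv n r : detD w n r = tdet (moment w GRing.inv) 2 1 n (- r).
Proof.
rewrite /detD -det_tr; congr (\det _); apply/matrixP => i j.
by rewrite !mxE fourier_coef_moment_inv; congr moment; ring.
Qed.

Lemma detE_tdet_inv n s : detE w n s = tdet (moment w GRing.inv) 1 2 n (- s).
Proof.
rewrite /detE -det_tr; congr (\det _); apply/matrixP => i j.
by rewrite !mxE fourier_coef_moment_inv; congr moment; ring.
Qed.

Lemma polyP_torth n r : detD w n r != 0 ->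
  torth (moment w id) 1 2 n r (Defs.polyP w n r).
Proof.
rewrite detD_tdet; apply: xget_torth => p.
have E (m : nat) : circle_int (fun x => p.[x] * x ^ (- (2 * m%:Z) - r) * w x) =
    lfun (moment w id) 1 (r + 2 * m%:Z) p.
  rewrite -(circle_form_lfun w_int circle_continuous_id circle_point_neq0).
  apply: eq_circle_int => s; rewrite expr1 opprD [- r + _]addrC.
  by rewrite [RHS]mulrC [w _ * _]mulrC mulrA.
by split=> -[mp sp op]; split=> // m mn; [rewrite -E | rewrite E]; apply: op.
Qed.

Lemma polyQ_torth n r : detD w n r != 0 ->
  torth (moment w GRing.inv) 2 1 n (- r) (polyQ w n r).
Proof.
rewrite detD_tdet_inv; apply: xget_torth => p.
have E (m : nat) : circle_int (fun x => p.[x ^- 2] * x ^ (m%:Z - r) * w x) =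
    lfun (moment w GRing.inv) 2 (- r + 1 * m%:Z) p.
  rewrite -(circle_form_lfun w_int circle_continuous_inv circle_point_inv_neq0).
  apply: eq_circle_int => s; rewrite exprVn exprz_inv opprK mul1r [- r + _]addrC.
  by rewrite [RHS]mulrC [w _ * _]mulrC mulrA.
by split=> -[mp sp op]; split=> // m mn; [rewrite -E | rewrite E]; apply: op.
Qed.

Lemma polyR_torth n s : detE w n s != 0 ->
  torth (moment w id) 2 1 n s (polyR w n s).
Proof.
rewrite detE_tdet; apply: xget_torth => p.
have E (m : nat) : circle_int (fun x => p.[x ^+ 2] * x ^ (- m%:Z - s) * w x) =
    lfun (moment w id) 2 (s + 1 * m%:Z) p.
  rewrite -(circle_form_lfun w_int circle_continuous_id circle_point_neq0).
  apply: eq_circle_int => t; rewrite mul1r opprD [- s + _]addrC.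
  by rewrite [RHS]mulrC [w _ * _]mulrC mulrA.
by split=> -[mp sp op]; split=> // m mn; [rewrite -E | rewrite E]; apply: op.
Qed.

Lemma polyS_torth n s : detE w n s != 0 ->
  torth (moment w GRing.inv) 1 2 n (- s) (polyS w n s).
Proof.
rewrite detE_tdet_inv; apply: xget_torth => p.
have E (m : nat) : circle_int (fun x => p.[x^-1] * x ^ (2 * m%:Z - s) * w x) =
    lfun (moment w GRing.inv) 1 (- s + 2 * m%:Z) p.
  rewrite -(circle_form_lfun w_int circle_continuous_inv circle_point_inv_neq0).
  apply: eq_circle_int => t; rewrite expr1 exprz_inv opprK [- s + _]addrC.
  by rewrite [RHS]mulrC [w _ * _]mulrC mulrA.
by split=> -[mp sp op]; split=> // m mn; [rewrite -E | rewrite E]; apply: op.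
Qed.

Lemma circle_point_neq (z : R[i]) : `|z| != 1 -> forall t : R,
  circle_point t - z != 0 /\ circle_point t ^+ 2 - z ^+ 2 != 0.
Proof.
move=> z1 t; split.
  rewrite subr_eq0; apply: contra z1 => /eqP <-; exact/eqP/norm_circle_point.
rewrite subr_eq0; apply: contra z1 => /eqP/(congr1 Num.norm).
rewrite !normrX norm_circle_point expr1n => /esym/eqP.
by rewrite sqrp_eq1.
Qed.

Lemma kernel2_continuous z : `|z| != 1 ->
  circle_continuous (fun x : R[i] => (x ^+ 2 + z ^+ 2) / (x ^+ 2 - z ^+ 2)).
Proof.
move=> z1; have cx := circle_continuousX 2 (@circle_continuous_id R).
apply: circle_continuousM.
  exact: circle_continuousD (circle_continuous_cst _).
apply: circle_continuousV; last exact: circle_continuousD (circle_continuous_cst _).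
by move=> t; case: (circle_point_neq z1 t).
Qed.

Lemma kernel1_continuous z : `|z| != 1 ->
  circle_continuous (fun x : R[i] => (x + z) / (x - z)).
Proof.
move=> z1; have cx := @circle_continuous_id R.
apply: circle_continuousM.
  exact: circle_continuousD (circle_continuous_cst _).
apply: circle_continuousV; last exact: circle_continuousD (circle_continuous_cst _).
by move=> t; case: (circle_point_neq z1 t).
Qed.

Lemma kernel2_mul z : `|z| != 1 -> forall t : R, let x := circle_point t in
  (x ^+ 2 + z ^+ 2) / (x ^+ 2 - z ^+ 2) * (x ^+ 2 - z ^+ 2) = 1 * (x ^+ 2 + z ^+ 2).
Proof. by move=> z1 t x; rewrite divfK ?mul1r //; case: (circle_point_neq z1 t). Qed.

Lemma kernel1_mul z : `|z| != 1 -> forall t : R, let x := circle_point t in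
  (x + z) / (x - z) * (x ^+ 2 - z ^+ 2) = 1 * (x + z) ^+ 2.
Proof.
move=> z1 t x; have [xz _] := circle_point_neq z1 t.
by rewrite subr_sqr mulrA divfK // mul1r expr2.
Qed.

(** In the variables 1/zeta and 1/z the kernel only changes sign, whence c = -1 where u = zeta has c
    = 1. *)
Lemma kernel2_mul_inv z : z != 0 -> `|z| != 1 -> forall t : R, let x := circle_point t in
  (x ^+ 2 + z ^+ 2) / (x ^+ 2 - z ^+ 2) * (x^-1 ^+ 2 - z^-1 ^+ 2) =
  - 1 * (x^-1 ^+ 2 + z^-1 ^+ 2).
Proof.
move=> z0 z1 t x; have [_ xz] := circle_point_neq z1 t; have := circle_point_neq0 t.
by move: xz; rewrite -/x => xz x0; field; rewrite ?x0 ?z0 ?xz.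
Qed.

Lemma kernel1_mul_inv z : z != 0 -> `|z| != 1 -> forall t : R, let x := circle_point t in
  (x + z) / (x - z) * (x^-1 ^+ 2 - z^-1 ^+ 2) = - 1 * (x^-1 + z^-1) ^+ 2.
Proof.
move=> z0 z1 t x; have [xz _] := circle_point_neq z1 t; have := circle_point_neq0 t.
by move: xz; rewrite -/x => xz x0; field; rewrite ?x0 ?z0 ?xz.
Qed.

End Specialization.

(** This and the next two lemmas match L2, L3 and L4 with the general operators, coefficients being
    variables. For L2, v = 1/z and a factor z^2 splits off. *)
Lemma double_degree_op_inv (F : fieldType)
    (z b2 b1 a1 b1' a1' b0 a0 k o1 o1' o0 f3 f2 f1 f0 : F) : z != 0 ->
  b2 = - k -> b1 + a1 = - o1 -> b1' + a1' = - o1' -> b0 + a0 = - o0 ->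
  z ^+ 2 * f3 - (1 + b2 * z ^+ 2) * f2 + (b1 + a1 + b1' + a1') * f1 -
    (b1' + a1') * (b0 + a0) * f0 =
  z ^+ 2 * (f3 + (k - z^-1 ^+ 2) * f2 - ((o1 + o1') * z^-1 ^+ 2) * f1 -
    (o1' * o0) * z^-1 ^+ 2 * f0).
Proof. by move=> z0 -> e1 e1' ->; rewrite -[b1 + a1 + _ + _]addrA e1 e1'; field. Qed.

Lemma double_degree_op (F : fieldType)
    (x b2 b1 a1 b1' a1' b0 a0 k o1 o1' o0 f3 f2 f1 f0 : F) :
  b2 = - k -> b1 + a1 = - o1 -> a1' + b1' = - o1' -> b0 + a0 = - o0 ->
  f3 - (x + b2) * f2 + (b1 + a1 + a1' + b1') * x * f1 -
    (a1' + b1') * (b0 + a0) * x * f0 =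
  f3 + (k - x) * f2 - ((o1 + o1') * x) * f1 - (o1' * o0) * x * f0.
Proof. by move=> -> e1 e1' ->; rewrite -[b1 + a1 + _ + _]addrA e1 e1'; ring. Qed.

Lemma double_offset_op_inv (F : fieldType)
    (x g2 g1' g1 th k2 k1' k1 o f3 f2 f1 f0 : F) :
  g2 = - k2 -> g1' = - k1' -> g1 = - k1 -> th + g1' = - o ->
  f3 - (g2 + g1') * f2 - (x - g1' * g1) * f1 + (th + g1') * x * f0 =
  f3 + (k2 + k1') * f2 + (k1' * k1 - x) * f1 - o * x * f0.
Proof. by move=> e2 e1' e1 ->; rewrite e2 e1 e1'; ring. Qed.

(** * Annihilation by each of the four operators *)

Section Operators.
Context {R : realType}.
Variables (w : R[i] -> R[i]) (z : R[i]) (n : nat).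
Hypothesis w_int : integrable_weight w.
Hypotheses (n_gt0 : (0 < n)%N) (z_neq0 : z != 0) (z_off_circle : `|z| != 1).

Let mem_range (P : nat -> Prop) k : (forall m, (n <= m <= n + k)%N -> P m) ->
  forall j, (j <= k)%N -> P (n + j)%N.
Proof. by move=> H j jk; apply: H; rewrite leq_addr leq_add2l. Qed.

Lemma opL1_vanish r :
  (forall m : nat, (n <= m <= n + 3)%N -> detD w m r != 0) ->
  (forall m : nat, (n <= m <= n + 2)%N -> detD w m (r - 1) != 0) ->
  detD w (n + 1) (r - 2) != 0 ->
  opL1 w r z (fun m => checkP w m r z) n = 0 /\
  opL1 w r z (fun m => hatP w m r z) n = 0.
Proof.
move=> /mem_range D /mem_range Da Db.
have D0 := D 0%N isT; have D1 := D 1%N isT; have D2 := D 2%N isT; have D3 := D 3%N isT.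
have Da0 := Da 0%N isT; have Da1 := Da 1%N isT; have Da2 := Da 2%N isT.
have t0 := polyP_torth w_int D0; have t1 := polyP_torth w_int D1.
have t2 := polyP_torth w_int D2; have t3 := polyP_torth w_int D3.
rewrite !detD_tdet ?addn0 ?addn1 ?addn2 ?addn3 in D0 D1 D2 D3 Da0 Da1 Da2 Db t0 t1 t2 t3.
have := double_offset_form w_int (@circle_continuous_id R) (@circle_point_neq0 R)
  (kernel2_continuous z_off_circle) (kernel2_mul z_off_circle) n_gt0
  D0 D1 D2 D3 Da1 Da2 Db t0 t1 t2 t3.
(* The fraction in [offset_coefE] at t = r is eta at r - 2. *)
have eta : coef_delta w n r + coef_eta w n (r - 2) = - offset_coef (moment w id) 1 2 n r.
  rewrite (offset_coefE D0 D1 Da0 Db) /coef_delta /coef_eta /coef_h !detD_tdet subrK.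
  by rewrite (_ : r - 2 + 1 = r - 1) ?opprB 1?addrC //; ring.
have hatE m : hatP w m r z = circle_form w
    (fun x => id x ^ (- r) * ((x ^+ 2 + z ^+ 2) / (x ^+ 2 - z ^+ 2)))
    (fun x => id x ^+ 1) (Defs.polyP w m r).
  by apply: eq_circle_int => t; rewrite !mulrA.
have checkE m : checkP w m r z = circle_form w
    (fun x => id x ^ (- r) * ((x ^+ 2 + z ^+ 2) / (x ^+ 2 - z ^+ 2)))
    (fun x => id x ^+ 1) (Defs.polyP w m r - (Defs.polyP w m r).[z]%:P).
  by apply: eq_circle_int => t; rewrite !mulrA hornerD hornerN hornerC.
have dE m t : coef_delta w m t = - degree_coef (moment w id) 1 2 m t.
  by rewrite /coef_delta /coef_h !detD_tdet.
have opE f : opL1 w r z f n = f n.+3 +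
    (degree_coef (moment w id) 1 2 n.+2 r + degree_coef (moment w id) 1 2 n.+1 (r - 1)) * f n.+2 +
    (degree_coef (moment w id) 1 2 n.+1 (r - 1) * degree_coef (moment w id) 1 2 n.+1 r - z ^+ 2) *
      f n.+1 - offset_coef (moment w id) 1 2 n r * z ^+ 2 * f n.
  by rewrite /opL1 eta ?addn1 ?addn2 ?addn3 !dE mulrNN -opprD !mulNr !opprK.
by rewrite /= -!hatE -!checkE !opE => -[].
Qed.

Lemma opL2_vanish r :
  (forall m : nat, (n <= m <= n + 3)%N -> detD w m r != 0) ->
  detD w (n + 1) (r + 1) != 0 -> detD w (n + 2) (r + 1) != 0 ->
  (forall m : nat, (n <= m <= n + 2)%N -> detD w m (r + 2) != 0) ->
  detD w (n + 1) (r + 3) != 0 ->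
  opL2 w r z (fun m => checkQ w m r z) n = 0 /\
  opL2 w r z (fun m => hatQ w m r z) n = 0.
Proof.
move=> /mem_range D Db1 Db2 /mem_range Da Dc.
have D0 := D 0%N isT; have D1 := D 1%N isT; have D2 := D 2%N isT; have D3 := D 3%N isT.
have Da0 := Da 0%N isT; have Da1 := Da 1%N isT; have Da2 := Da 2%N isT.
have t0 := polyQ_torth w_int D0; have t1 := polyQ_torth w_int D1.
have t2 := polyQ_torth w_int D2; have t3 := polyQ_torth w_int D3.
set mu := moment w GRing.inv in t0 t1 t2 t3.
have DE m k : detD w m (r + k) = tdet mu 2 1 m (- r - k).
  by rewrite detD_tdet_inv opprD.
have DE0 m : detD w m r = tdet mu 2 1 m (- r) by rewrite detD_tdet_inv.
rewrite ?DE ?DE0 ?addn0 ?addn1 ?addn2 ?addn3 in D0 D1 D2 D3 Da0 Da1 Da2 Db1 Db2 Dc t0 t1 t2 t3.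
have key := double_degree_form w_int circle_continuous_inv (@circle_point_inv_neq0 R)
  (kernel1_continuous z_off_circle) (kernel1_mul_inv z_neq0 z_off_circle) n_gt0
  D0 D1 D2 D3 Db1 Db2 Da2 t0 t1 t2 t3.
have bE m k : coef_beta w m (r + k) = - degree_coef mu 2 1 m (- r - k).
  by rewrite /coef_beta /coef_h /degree_coef /thn -addrA !DE opprD addrA.
have bE0 m : coef_beta w m r = - degree_coef mu 2 1 m (- r).
  by rewrite /coef_beta /coef_h !DE !DE0.
have c0 : coef_beta w n r + coef_alpha w n (r + 1) = - offset_coef mu 2 1 n (- r).
  rewrite (offset_coefE D0 D1 Da0 Db1) bE0 /coef_alpha addrK -!addrA !DE !DE0 opprB [RHS]addrC.
  by have [-> ->] : - r - (1 + 2) = - r - 1 - 2 /\ - r - (1 + 1) = - r - 2 by split; ring.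
have c1 : coef_beta w n.+1 r + coef_alpha w n.+1 (r + 1) = - offset_coef mu 2 1 n.+1 (- r).
  rewrite (offset_coefE D1 D2 Da1 Db2) bE0 /coef_alpha addrK -!addrA !DE !DE0 opprB [RHS]addrC.
  by have [-> ->] : - r - (1 + 2) = - r - 1 - 2 /\ - r - (1 + 1) = - r - 2 by split; ring.
(* The second offset step starts at t - 1 = -(r + 1); its D_{n+1}(t-1-a) is the determinant with
   index r + 3. *)
have c2 : coef_beta w n.+1 (r + 1) + coef_alpha w n.+1 (r + 2) =
    - offset_coef mu 2 1 n.+1 (- r - 1).
  have e2 : - r - 1 - 1 = - r - 2 by ring.
  have e3 : - r - 1 - 2 = - r - 3 by ring.
  have := @offset_coefE _ mu 2 1 n.+1 (- r - 1).
  rewrite e2 e3 => /(_ Db1 Db2 Dc Da2) ->.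
  rewrite bE /coef_alpha -!addrA !DE opprB [RHS]addrC.
  have -> : - r - (2 + 2) = - r - 2 - 2 by ring.
  by have [-> ->] : - r - (2 + 1) = - r - 3 /\ - r - (2 - 1) = - r - 1 by split; ring.
have hatE m : hatQ w m r z = circle_form w
    (fun x => x^-1 ^ (- - r) * ((x + z) / (x - z))) (fun x => x^-1 ^+ 2) (polyQ w m r).
  by apply: eq_circle_int => t; rewrite opprK exprz_inv exprVn !mulrA.
have checkE m : checkQ w m r z = circle_form w
    (fun x => x^-1 ^ (- - r) * ((x + z) / (x - z))) (fun x => x^-1 ^+ 2)
    (polyQ w m r - (polyQ w m r).[z^-1 ^+ 2]%:P).
  apply: eq_circle_int => t.
  by rewrite opprK exprz_inv !exprVn !mulrA hornerD hornerN hornerC.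
have opE f : opL2 w r z f n = z ^+ 2 * (f n.+3 +
    (degree_coef mu 2 1 n.+2 (- r) - z^-1 ^+ 2) * f n.+2 -
    ((offset_coef mu 2 1 n.+1 (- r) + offset_coef mu 2 1 n.+1 (- r - 1)) * z^-1 ^+ 2) * f n.+1 -
    (offset_coef mu 2 1 n.+1 (- r - 1) * offset_coef mu 2 1 n (- r)) * z^-1 ^+ 2 * f n).
  rewrite /opL2 addn1 addn2 addn3.
  exact: double_degree_op_inv z_neq0 (bE0 _) c1 c2 c0.
by move: key; rewrite /= -!hatE -!checkE !opE => -[-> ->]; rewrite mulr0.
Qed.

Lemma opL3_vanish s :
  (forall m : nat, (n <= m <= n + 3)%N -> detE w m s != 0) ->
  detE w (n + 1) (s - 1) != 0 -> detE w (n + 2) (s - 1) != 0 ->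
  (forall m : nat, (n <= m <= n + 2)%N -> detE w m (s - 2) != 0) ->
  opL3 w s z (fun m => checkR w m s z) n = 0 /\
  opL3 w s z (fun m => hatR w m s z) n = 0.
Proof.
move=> /mem_range D Db1 Db2 /mem_range Da.
have D0 := D 0%N isT; have D1 := D 1%N isT; have D2 := D 2%N isT; have D3 := D 3%N isT.
have Da0 := Da 0%N isT; have Da1 := Da 1%N isT; have Da2 := Da 2%N isT.
have t0 := polyR_torth w_int D0; have t1 := polyR_torth w_int D1.
have t2 := polyR_torth w_int D2; have t3 := polyR_torth w_int D3.
rewrite !detE_tdet ?addn0 ?addn1 ?addn2 ?addn3 in D0 D1 D2 D3 Da0 Da1 Da2 Db1 Db2 t0 t1 t2 t3.
have key := double_degree_form w_int (@circle_continuous_id R) (@circle_point_neq0 R)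
  (kernel1_continuous z_off_circle) (kernel1_mul z_off_circle) n_gt0
  D0 D1 D2 D3 Db1 Db2 Da2 t0 t1 t2 t3.
have kE m t : coef_kappa w m t = - degree_coef (moment w id) 2 1 m t.
  by rewrite /coef_kappa /coef_g /degree_coef /thn !detE_tdet.
have e2 : s - 1 - 1 = s - 2 by ring.
have c0 : coef_kappa w n s + coef_rho w n (s - 1) = - offset_coef (moment w id) 2 1 n s.
  rewrite (offset_coefE D0 D1 Da0 Db1) kE /coef_rho !detE_tdet subrK e2.
  by rewrite opprB [RHS]addrC.
have c1 : coef_kappa w n.+1 s + coef_rho w n.+1 (s - 1) = - offset_coef (moment w id) 2 1 n.+1 s.
  rewrite (offset_coefE D1 D2 Da1 Db2) kE /coef_rho !detE_tdet subrK e2.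
  by rewrite opprB [RHS]addrC.
(* L3 writes this coefficient at level n + 2 and index s, hence [offset_coefE']; [offset_coefE]
   would bring in E_{n+1} at index s - 3. *)
have c2 : coef_rho w n.+2 s + coef_kappa w n.+2 s =
    - offset_coef (moment w id) 2 1 n.+1 (s - 1).
  have := @offset_coefE' _ (moment w id) 2 1 n.+1 (s - 1).
  have [-> ->] : s - 1 + 2 - 1 = s /\ s - 1 + 2 = s + 1 by split; ring.
  rewrite e2 => /(_ Db1 Db2 D2 D3 Da2) ->.
  by rewrite kE /coef_rho !detE_tdet opprB.
have hatE m : hatR w m s z = circle_form w
    (fun x => id x ^ (- s) * ((x + z) / (x - z))) (fun x => id x ^+ 2) (polyR w m s).
  by apply: eq_circle_int => t; rewrite !mulrA.
have checkE m : checkR w m s z = circle_form w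
    (fun x => id x ^ (- s) * ((x + z) / (x - z))) (fun x => id x ^+ 2)
    (polyR w m s - (polyR w m s).[z ^+ 2]%:P).
  by apply: eq_circle_int => t; rewrite !mulrA hornerD hornerN hornerC.
have opE f : opL3 w s z f n = f n.+3 +
    (degree_coef (moment w id) 2 1 n.+2 s - z ^+ 2) * f n.+2 -
    ((offset_coef (moment w id) 2 1 n.+1 s + offset_coef (moment w id) 2 1 n.+1 (s - 1)) *
      z ^+ 2) * f n.+1 -
    (offset_coef (moment w id) 2 1 n.+1 (s - 1) * offset_coef (moment w id) 2 1 n s) *
      z ^+ 2 * f n.
  rewrite /opL3 addn1 addn2 addn3.
  exact: double_degree_op (kE _ _) c1 c2 c0.
by move: key; rewrite /= -!hatE -!checkE !opE => -[].
Qed.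

Lemma opL4_vanish s :
  (forall m : nat, (n <= m <= n + 3)%N -> detE w m s != 0) ->
  detE w (n + 1) (s + 1) != 0 -> detE w (n + 2) (s + 1) != 0 ->
  detE w (n + 1) (s + 2) != 0 ->
  opL4 w s z (fun m => checkS w m s z) n = 0 /\
  opL4 w s z (fun m => hatS w m s z) n = 0.
Proof.
move=> /mem_range D Db1 Db2 Dc.
have D0 := D 0%N isT; have D1 := D 1%N isT; have D2 := D 2%N isT; have D3 := D 3%N isT.
have t0 := polyS_torth w_int D0; have t1 := polyS_torth w_int D1.
have t2 := polyS_torth w_int D2; have t3 := polyS_torth w_int D3.
set mu := moment w GRing.inv in t0 t1 t2 t3.
have DE m k : detE w m (s + k) = tdet mu 1 2 m (- s - k).
  by rewrite detE_tdet_inv opprD.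
have DE0 m : detE w m s = tdet mu 1 2 m (- s) by rewrite detE_tdet_inv.
rewrite ?DE ?DE0 ?addn0 ?addn1 ?addn2 ?addn3 in D0 D1 D2 D3 Db1 Db2 Dc t0 t1 t2 t3.
have key := double_offset_form w_int circle_continuous_inv (@circle_point_inv_neq0 R)
  (kernel2_continuous z_off_circle) (kernel2_mul_inv z_neq0 z_off_circle) n_gt0
  D0 D1 D2 D3 Db1 Db2 Dc t0 t1 t2 t3.
have gE m k : coef_gamma w m (s + k) = - degree_coef mu 1 2 m (- s - k).
  by rewrite /coef_gamma /coef_g /degree_coef /thn -addrA !DE opprD addrA.
have gE0 m : coef_gamma w m s = - degree_coef mu 1 2 m (- s).
  by rewrite /coef_gamma /coef_g /degree_coef /thn !DE !DE0.
(* The offset coefficient of level n at t = -s, rewritten at level n + 1 and index s + 1; its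
   D_{n+1}(t-b) is the determinant with index s + 2. *)
have c0 : coef_theta w n.+1 (s + 1) + coef_gamma w n.+1 (s + 1) =
    - offset_coef mu 1 2 n (- s).
  have := @offset_coefE' _ mu 1 2 n (- s).
  have -> : - s + 1 - 2 = - s - 1 by ring.
  move=> /(_ D0 D1 Db1 Db2 Dc) ->.
  rewrite gE /coef_theta /degree_coef addrK -!addrA !DE !DE0 [RHS]opprB.
  have -> : - s - (1 - 2) = - s + 1 by ring.
  by have -> : - s - (1 + 1) = - s - 2 by ring.
have hatE m : hatS w m s z = circle_form w
    (fun x => x^-1 ^ (- - s) * ((x ^+ 2 + z ^+ 2) / (x ^+ 2 - z ^+ 2)))
    (fun x => x^-1 ^+ 1) (polyS w m s).
  by apply: eq_circle_int => t; rewrite opprK exprz_inv !mulrA.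
have checkE m : checkS w m s z = circle_form w
    (fun x => x^-1 ^ (- - s) * ((x ^+ 2 + z ^+ 2) / (x ^+ 2 - z ^+ 2)))
    (fun x => x^-1 ^+ 1) (polyS w m s - (polyS w m s).[z^-1]%:P).
  by apply: eq_circle_int => t; rewrite opprK exprz_inv !mulrA hornerD hornerN hornerC.
have opE f : opL4 w s z f n = f n.+3 +
    (degree_coef mu 1 2 n.+2 (- s) + degree_coef mu 1 2 n.+1 (- s - 1)) * f n.+2 +
    (degree_coef mu 1 2 n.+1 (- s - 1) * degree_coef mu 1 2 n.+1 (- s) - z^-1 ^+ 2) * f n.+1 -
    offset_coef mu 1 2 n (- s) * z^-1 ^+ 2 * f n.
  rewrite /opL4 addn1 addn2 addn3 exprVn.
  exact: double_offset_op_inv (gE0 _) (gE _ _) (gE0 _) c0.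
by move: key; rewrite /= -!hatE -!checkE !opE => -[].
Qed.

End Operators.

Theorem theorem6p1 (R : realType) (w : R[i] -> R[i])
    (w_int : integrable_weight w)
    (n : nat) (n_ge1 : (1 <= n)%N) (r s : int)
    (z : R[i]) (z_neq0 : z != 0) (z_off_circle : `|z| != 1) :
  [/\ (forall m : nat, (n <= m <= n + 3)%N -> detD w m r != 0) ->
      (forall m : nat, (n <= m <= n + 2)%N -> detD w m (r - 1) != 0) ->
      detD w (n + 1) (r - 2) != 0 ->
      opL1 w r z (fun m => checkP w m r z) n = 0 /\
      opL1 w r z (fun m => hatP w m r z) n = 0,
      (forall m : nat, (n <= m <= n + 3)%N -> detD w m r != 0) ->
      detD w (n + 1) (r + 1) != 0 ->
      detD w (n + 2) (r + 1) != 0 ->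
      (forall m : nat, (n <= m <= n + 2)%N -> detD w m (r + 2) != 0) ->
      detD w (n + 1) (r + 3) != 0 ->
      opL2 w r z (fun m => checkQ w m r z) n = 0 /\
      opL2 w r z (fun m => hatQ w m r z) n = 0,
      (forall m : nat, (n <= m <= n + 3)%N -> detE w m s != 0) ->
      detE w (n + 1) (s - 1) != 0 ->
      detE w (n + 2) (s - 1) != 0 ->
      (forall m : nat, (n <= m <= n + 2)%N -> detE w m (s - 2) != 0) ->
      opL3 w s z (fun m => checkR w m s z) n = 0 /\
      opL3 w s z (fun m => hatR w m s z) n = 0
    & (forall m : nat, (n <= m <= n + 3)%N -> detE w m s != 0) ->
      detE w (n + 1) (s + 1) != 0 ->
      detE w (n + 2) (s + 1) != 0 ->
      detE w (n + 1) (s + 2) != 0 ->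
      opL4 w s z (fun m => checkS w m s z) n = 0 /\
      opL4 w s z (fun m => hatS w m s z) n = 0].
Proof.
by split; [exact: opL1_vanish | exact: opL2_vanish | exact: opL3_vanish | exact: opL4_vanish].
Qed.
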